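(* Let $a$ and $b$ be real numbers such that $a \ge -1$, $b \neq 0$ and $\frac{a}{b} \ge -1$. Let $k \ge 2$ be an integer and let $G \in \mathcal{G}_1$ be a graph of order $n$ with minimum degree $\delta \ge 2k+2$. Then $G$ has property $P(k, \delta)$ if one of the following conditions holds: (i) $\lambda_3(G, a) < (a+1)\delta - \frac{16\left(k+\frac{\delta-1}{\delta}\right)}{3(\delta+1)}$; (ii) $b > 0$ and $\lambda_3(G, a, b) < (a+b)\delta - \frac{16b\left(k+\frac{\delta-1}{\delta}\right)}{3(\delta+1)}$; (iii) $b < 0$ and $\lambda_{n-2}(G, a, b) > (a+b)\delta - \frac{16b\left(k+\frac{\delta-1}{\delta}\right)}{3(\delta+1)}$.
   Context: All graphs are finite, undirected and simple. For a graph $G$ of order $n$, let $A(G)$ be its adjacency matrix and $D(G)$ the diagonal matrix of vertex degrees. For real $a,b$, $\lambda_i(G,a)$ and $\lambda_i(G,a,b)$ denote the $i$-th largest eigenvalue (counted with multiplicity) of the matrices $aD(G)+A(G)$ and $aD(G)+bA(G)$, respectively. For disjoint $X,Y\subseteq V(G)$, $e(X,Y)$ is the number of edges of $G$ with one endpoint in $X$ and the other in $Y$. $\kappa'(G)$ is the edge connectivity of $G$. For a positive integer $t$, $\mathcal{G}_t$ is the set of simple graphs $G$ that contain at least $t+1$ non-empty pairwise disjoint proper subsets $V_1,\ldots,V_{t+1}$ of $V(G)$ such that $V(G)\setminus\bigcup_{i=1}^{t+1}V_i\neq\emptyset$ and $\kappa'(G)=e(V_i,V(G)\setminus V_i)$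 for every $i=1,\ldots,t+1$. For positive integers $k,d$, a graph $G$ of order $n$ has property $P(k,d)$ if: (a) $G$ contains $k$ pairwise edge-disjoint spanning trees; (b) apart from these $k$ edge-disjoint spanning trees (i.e. edge-disjoint from them), there exists another forest $F$ in $G$ with number of edges $|E(F)|>\frac{d-1}{d}(n-1)$; and (c) if $F$ is not a spanning tree of $G$, then $F$ has a component with at least $d$ edges. *)

(* Defs.v *)
From mathcomp Require Import all_boot all_order all_algebra.
From mathcomp Require Import reals.
From mathcomp Require Import polyrcf.

Set Implicit Arguments.
Unset Strict Implicit.
Unset Printing Implicit Defensive.

Import Order.TTheory GRing.Theory Num.Theory.

Record sgraph := SGraph {
  vertex :> finType;
  adj : rel vertex;
  adj_sym : symmetric adj;
  adj_irrefl : irreflexive adj }.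

Definition edges (G : sgraph) : {set {set G}} :=
  [set [set p.1; p.2] | p : G * G & adj p.1 p.2].

Definition degree (G : sgraph) (x : G) : nat := #|[set y | adj x y]|.

(* [#|G|] exceeds every degree, so the default value only matters for the
   graph without vertices (where it gives 0). *)
Definition min_degree (G : sgraph) : nat :=
  \big[minn/#|G|]_(x : G) degree x.

Definition edges_between (G : sgraph) (X Y : {set G}) : nat :=
  #|[set f in edges G | [exists x in X, exists y in Y, f == [set x; y]]]|.

(* A set [F] of edges stands for the spanning subgraph [(V(G), F)], so a forest
   may have isolated vertices as components, with no edges. *)

Definition adj_in (G : sgraph) (F : {set {set G}}) : rel G :=
  [rel x y | (x != y) && ([set x; y] \in F)].

Definition connected_by (G : sgraph) (F : {set {set G}}) : bool :=
  [forall x : G, forall y : G, connect (adj_in F) x y].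

Definition acyclic_by (G : sgraph) (F : {set {set G}}) : Prop :=
  forall c : seq G, 2 < size c -> ~ ucycle (adj_in F) c.

Definition is_forest (G : sgraph) (F : {set {set G}}) : Prop :=
  F \subset edges G /\ acyclic_by F.

Definition is_spanning_tree (G : sgraph) (F : {set {set G}}) : Prop :=
  is_forest F /\ connected_by F.

Definition component_edges (G : sgraph) (F : {set {set G}}) (x : G) :
    {set {set G}} :=
  [set f in F | f \subset [set y | connect (adj_in F) x y]].

(* Least number of edges whose removal disconnects [G].  If [G] has at least
   two vertices, removing all edges disconnects it, so the default value
   [#|edges G|] is never below the minimum; for at most one vertex it
   yields 0. *)
Definition edge_connectivity (G : sgraph) : nat :=
  \big[minn/#|edges G|]_(S : {set {set G}}
     | (S \subset edges G) && ~~ connected_by (edges G :\: S)) #|S|.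

Definition in_class (t : nat) (G : sgraph) : Prop :=
  exists V : 'I_t.+1 -> {set G},
    [/\ forall i, V i != set0 /\ V i \proper [set: G],
        forall i j, i != j -> [disjoint V i & V j],
        [set: G] :\: \bigcup_(i < t.+1) V i != set0
      & forall i, edge_connectivity G = edges_between (V i) ([set: G] :\: V i)].

Definition propertyP (k d : nat) (G : sgraph) : Prop :=
  exists T : 'I_k -> {set {set G}},
    [/\ forall i, is_spanning_tree (T i),
        forall i j, i != j -> [disjoint T i & T j]
      & exists F : {set {set G}},
          [/\ is_forest F,
              forall i, [disjoint F & T i],
              ((d%:R - 1) / d%:R * (#|G|%:R - 1) < #|F|%:R :> rat)%R
            & ~ is_spanning_tree F ->
              exists x : G, d <= #|component_edges F x|]].

Local Open Scope ring_scope.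

Definition adjacency_mx (R : realType) (G : sgraph) : 'M[R]_#|G| :=
  \matrix_(i, j) (adj (enum_val i) (enum_val j))%:R.

Definition degree_mx (R : realType) (G : sgraph) : 'M[R]_#|G| :=
  diag_mx (\row_i (degree (enum_val i))%:R).

(* The real roots of the characteristic polynomial in nonincreasing order,
   repeated according to their multiplicity; for a symmetric matrix this is
   the whole spectrum. *)
Definition eigenvalues (R : realType) (n : nat) (M : 'M[R]_n) : seq R :=
  sort (fun x y => y <= x)
    (flatten [seq nseq (mup x (char_poly M)) x | x <- rootsR (char_poly M)]).

(* The [i]-th largest eigenvalue, with [i] counted from 1. *)
Definition nth_eigenvalue (R : realType) (n : nat) (i : nat) (M : 'M[R]_n) : R :=
  nth 0 (eigenvalues M) i.-1.

Definition lambda1 (R : realType) (i : nat) (G : sgraph) (a : R) : R :=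
  nth_eigenvalue i (a *: degree_mx R G + adjacency_mx R G).

Definition lambda2 (R : realType) (i : nat) (G : sgraph) (a b : R) : R :=
  nth_eigenvalue i (a *: degree_mx R G + b *: adjacency_mx R G).

(* Main.v *)
From HB Require Import structures.
Require Import Defs.
From mathcomp Require Import all_boot all_order all_algebra.
From mathcomp Require Import spectral sesquilinear reals polyrcf complex.
From mathcomp Require Import zify ring lra.

(** The graph [G] even has [k + 1] pairwise edge-disjoint spanning trees; the
    last of them serves as the forest [F], for which the bound on the number of
    edges is clear and the condition on components is void.

    By the theorem of Nash-Williams and Tutte ([tree_packing]) it is enough that
    every partition [P] of the vertices is crossed by at least
    [(k + 1) (#|P| - 1)] edges. This follows by adding up the boundaries of the
    blocks ([crossing_bound]), provided that every nonempty proper vertex set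
    has at least [k + 1] boundary edges and that at most two blocks have fewer
    than [2 k + 2] of them.

    Both provisos come from one spectral fact ([three_small_cuts]): the
    condition on the third eigenvalue, counted from the top or (for [b < 0]) from
    the bottom, excludes three pairwise disjoint nonempty
    sets with at most [2 k + 1] boundary edges each. As [2 k + 1] is less than
    the minimum degree [delta], each of the three sets would have more than
    [delta] vertices. On the combinations [x] of their indicator vectors the
    Laplacian form [L] would therefore be at most
    [2 (2 k + 1) / (delta + 1)] times the squared norm of [x], and because
    [a D + b A = (a + b) D - b L], the Courant-Fischer theorem would put the
    eigenvalue on the wrong side of the threshold. For the lower bound on
    boundaries, the class [in_class 1] supplies two disjoint minimum cuts with a
    nonempty rest, and the boundary of the rest is at most twice the edge
    connectivity ([edge_connectivity_gt]).

    The packing theorem is proved as Edmonds' theorem on disjoint bases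
    ([disjoint_bases]) for the vectors [x + y], one for each edge [xy], over the
    field with two elements. The Courant-Fischer bounds ([nth_eigenvalue_ge],
    [nth_eigenvalue_le]) are derived from the spectral theorem for Hermitian
    matrices by counting nonnegative eigenvalues. *)

Set Implicit Arguments.
Unset Strict Implicit.
Unset Printing Implicit Defensive.
Import Order.TTheory GRing.Theory Num.Theory.

(** * Disjoint bases of a family of vectors *)

Section VectorFamily.
Variables (K : fieldType) (vT : vectType K) (E : finType) (v : E -> vT).
Implicit Types (A B : {set E}) (e f : E).

Definition vspan A : {vspace vT} := (\sum_(e in A) <[v e]>)%VS.

(** Since [vspan A] is spanned by [#|A|] vectors, this says that the family
    [v] is linearly independent on [A]. *)
Definition indep A := #|A| <= \dim (vspan A).

Lemma mem_vspan e A : e \in A -> v e \in vspan A.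
Proof. by move=> eA; rewrite memvE; apply: (sumv_sup e). Qed.

Lemma vspan_subP A (U : {vspace vT}) :
  reflect (forall e, e \in A -> v e \in U) (vspan A <= U)%VS.
Proof. by apply: (iffP subv_sumP) => sAU e /sAU; rewrite memvE. Qed.

Lemma vspanS A B : A \subset B -> (vspan A <= vspan B)%VS.
Proof. by move=> sAB; apply/vspan_subP => e /(subsetP sAB)/mem_vspan. Qed.

Lemma vspanU A B : vspan (A :|: B) = (vspan A + vspan B)%VS.
Proof.
apply/eqP; rewrite eqEsubv subv_add !vspanS ?subsetUl ?subsetUr //= andbT.
apply/vspan_subP => e /setUP[] /mem_vspan; first exact/subvP/addvSl.
exact/subvP/addvSr.
Qed.

Lemma vspan1 e : vspan [set e] = <[v e]>%VS.
Proof. by rewrite /vspan big_set1. Qed.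

Lemma dim_vspan A : \dim (vspan A) <= #|A|.
Proof.
rewrite /vspan; apply: (leq_trans (dimv_leq_sum _ _ _)); rewrite -sum1_card.
by apply: leq_sum => e _; rewrite dim_vline leq_b1.
Qed.

Lemma indepS A B : A \subset B -> indep B -> indep A.
Proof.
move=> sAB; rewrite /indep => iB.
have : \dim (vspan B) <= \dim (vspan A) + \dim (vspan (B :\: A)).
  by rewrite -{1}(setID B A) (setIidPr sAB) vspanU dimv_add_leqif.
have := dim_vspan (B :\: A); have := cardsID A B; rewrite (setIidPr sAB).
by move: iB; lia.
Qed.

Lemma indepU1 e A : indep A -> v e \notin vspan A -> indep (e |: A).
Proof.
rewrite /indep => iA eA; have eNA : e \notin A by apply: contra eA; apply: mem_vspan.
rewrite cardsU1 eNA vspanU vspan1 dimv_disjoint_sum ?dim_vline.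
  by rewrite leq_add // lt0b; apply: contraNneq eA => ->; rewrite mem0v.
apply/eqP; rewrite -subv0; apply/subvP => x /memv_capP[/vlineP[t ->] tA].
by move: tA; rewrite rpredZeq (negPf eA) orbF => /eqP->; rewrite scale0r mem0v.
Qed.

Lemma indep_notin f A : indep A -> f \in A -> v f \notin vspan (A :\ f).
Proof.
rewrite /indep => iA fA; apply/negP => fsp; have := dim_vspan (A :\ f).
have : vspan A = vspan (A :\ f).
  by rewrite -{1}(setD1K fA) vspanU vspan1; apply/addv_idPr; rewrite -memvE.
by rewrite (cardsD1 f A) fA in iA; move: iA => /[swap] ->; lia.
Qed.

(** Expand [v e] on the basis [A] of [vspan A]: an element of [A] occurs with a
    nonzero coefficient exactly when [v e] leaves the span after its removal.
    The set in the statement is thus the fundamental circuit of [e] in [A],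
    minus [e] itself, i.e. the elements that can be exchanged for [e]. *)
Lemma vspan_circuit e A : indep A -> v e \in vspan A ->
  v e \in vspan [set f in A | v e \notin vspan (A :\ f)].
Proof.
move=> iA /memv_sumP[u uP ue].
have veE : v e = (\sum_(f in A | v e \notin vspan (A :\ f)) u f)%R.
  rewrite {1}ue (bigID (fun f => v e \notin vspan (A :\ f))) /= addrC big1 ?add0r // => f.
  rewrite negbK => /andP[fA]; have /vlineP[t uf] := uP f fA.
  rewrite {1}ue (bigD1 f) //= => vesp.
  suff: u f \in vspan (A :\ f).
    rewrite uf rpredZeq (negPf (indep_notin iA fA)) orbF => /eqP->.
    by rewrite scale0r.
  move: vesp; rewrite rpredDr //.
  apply: memv_suml => g /andP[gA gf]; have /vlineP[s ->] := uP g gA.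
  by rewrite memvZ // mem_vspan // !inE gf.
rewrite {1}veE; apply: memv_suml => f fP; have /andP[fA _] := fP; have /vlineP[t ->] := uP f fA.
by rewrite memvZ // mem_vspan // inE.
Qed.

Variable m : nat.
Implicit Types (c : {ffun E -> option 'I_m}) (i : 'I_m).

(** A partial colouring of [E] by [m] colours encodes [m] pairwise disjoint
    subsets of [E], its colour classes, together with the uncoloured rest. *)
Definition colour c i := [set e | c e == Some i].
Definition valid c := [forall i, indep (colour c i)].
Definition coloured c := [set e | c e != None].
Definition optimal c :=
  valid c && [forall c', valid c' ==> (#|coloured c'| <= #|coloured c|)].

Definition recolour c e i : {ffun E -> option 'I_m} :=
  [ffun x => if x == e then Some i else c x].
Definition swap c e i f : {ffun E -> option 'I_m} :=
  [ffun x => if x == e then Some i else if x == f then None else c x].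

(** The third condition says that [f] lies in the fundamental circuit of [e] in
    its class, so that an exchange keeps every class independent; it also keeps
    the number of coloured elements. *)
Definition exchange : rel {ffun E -> option 'I_m} := [rel c c' : {ffun E -> option 'I_m} |
  [exists e, exists i, exists f,
    [&& c e == None, f \in colour c i, v e \notin vspan (colour c i :\ f)
      & c' == swap c e i f]]].

Lemma exchangeP c c' :
  reflect (exists e i f, [/\ c e = None, f \in colour c i,
             v e \notin vspan (colour c i :\ f) & c' = swap c e i f])
          (exchange c c').
Proof.
apply: (iffP existsP) => [[e /existsP[i /existsP[f /and4P[/eqP ? ? ? /eqP ?]]]]|].
  by exists e, i, f.
move=> [e [i [f [ce fi vi c'E]]]]; exists e; apply/existsP; exists i.
by apply/existsP; exists f; rewrite ce fi vi c'E !eqxx.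
Qed.

Lemma colour_swap c e i f j : c e = None -> f \in colour c i ->
  colour (swap c e i f) j =
    if j == i then e |: (colour c i :\ f) else colour c j.
Proof.
rewrite inE => ce /eqP cf; apply/setP => x; case: (eqVneq j i) => [->|ji]; rewrite !inE ffunE.
  case: (eqVneq x e) => [_|xe] /=; first by rewrite eqxx.
  by case: (eqVneq x f) => [_|xf].
case: (eqVneq x e) => [->|xe]; first by rewrite ce; apply/eqP => -[/eqP]; rewrite eq_sym (negPf ji).
case: (eqVneq x f) => [->|xf] //; rewrite cf.
by symmetry; apply/eqP => -[/eqP]; rewrite eq_sym (negPf ji).
Qed.

Lemma exchange_optimal c c' : exchange c c' -> optimal c -> optimal c'.
Proof.
move=> /exchangeP[e [i [f [ce fi vef ->]]]] /andP[/forallP vc /forallP oc].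
apply/andP; split.
  apply/forallP => j; rewrite colour_swap //; case: eqP => // _.
  by apply: indepU1 => //; apply: indepS (vc i); apply: subD1set.
suff -> : #|coloured (swap c e i f)| = #|coloured c| by apply/forallP.
have cf : c f = Some i by apply/eqP; rewrite inE in fi.
have -> : coloured (swap c e i f) = e |: (coloured c :\ f).
  by apply/setP => x; rewrite !inE ffunE; case: (eqVneq x e); case: (eqVneq x f).
by rewrite cardsU1 !inE ce andbF [in RHS](cardsD1 f) inE cf.
Qed.

(** Otherwise [e] could receive the colour [i]. *)
Lemma optimal_span c e i : optimal c -> c e = None -> v e \in vspan (colour c i).
Proof.
move=> /andP[/forallP vc /forallP oc] ce; apply/negPn/negP => ei.
have : valid (recolour c e i).
  apply/forallP => j; case: (eqVneq j i) => [->|ji].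
    have -> : colour (recolour c e i) i = e |: colour c i; last exact: indepU1.
    by apply/setP => x; rewrite !inE ffunE; case: (eqVneq x e); rewrite ?eqxx.
  have -> // : colour (recolour c e i) j = colour c j.
  apply/setP => x; rewrite !inE ffunE; case: (eqVneq x e) => // ->.
  by rewrite ce; apply/eqP => -[/eqP]; rewrite eq_sym (negPf ji).
have /implyP /[apply] := oc (recolour c e i).
have -> : coloured (recolour c e i) = e |: coloured c.
  by apply/setP => x; rewrite !inE ffunE; case: (eqVneq x e).
by rewrite cardsU1 inE ce ltnn.
Qed.

Section Reach.
Variable c0 : {ffun E -> option 'I_m}.
Hypothesis opt0 : optimal c0.

(** Every class of [c0] will turn out to span this set: it is the set on which
    the rank bound of Edmonds' theorem is tight. *)
Definition residue := [set e | [exists c, connect exchange c0 c && (c e == None)]].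

Lemma mem_residue c e : connect exchange c0 c -> c e = None -> e \in residue.
Proof. by move=> cc ce; rewrite inE; apply/existsP; exists c; rewrite cc ce eqxx. Qed.

Lemma reach_optimal c : connect exchange c0 c -> optimal c.
Proof.
case/connectP => p; elim/last_ind: p c => [|p c1 IH] c /=; first by move=> _ ->.
rewrite rcons_path last_rcons => /andP[/IH /(_ erefl) + + ->] => + e.
exact: exchange_optimal e.
Qed.

(** The fundamental circuit of [e] in the class [i] lies in the residue, since
    each of its elements can be uncoloured by one more exchange. *)
Lemma reach_span c e i : connect exchange c0 c -> c e = None ->
  v e \in vspan (colour c i :&: residue).
Proof.
move=> cc ce; have oc := reach_optimal cc.
have ic : indep (colour c i) by case/andP: oc => /forallP.
apply: subvP (vspanS _) _ (vspan_circuit ic (optimal_span i oc ce)).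
apply/subsetP => f; rewrite !inE => /andP[fi vef]; rewrite fi /=.
apply/existsP; exists (swap c e i f); rewrite ffunE eqxx.
case: (eqVneq f e) fi => [->|_ fi]; first by rewrite ce.
rewrite eqxx andbT; apply: connect_trans cc (connect1 _).
by apply/exchangeP; exists e, i, f; rewrite inE fi.
Qed.

(** The only new element of a class after an exchange is the [e] that was
    uncoloured before, and [reach_span] places [v e] in the span of the old
    class within the residue. *)
Lemma reach_subspan c i : connect exchange c0 c ->
  (vspan (colour c i :&: residue) <= vspan (colour c0 i :&: residue))%VS.
Proof.
move=> cc; have /connectP[p pp cE] := cc.
elim/last_ind: p c cc pp cE => [|p c2 IH] c cc /=; first by move=> _ ->; apply: subvv.
rewrite rcons_path last_rcons => /andP[pp] + cE; rewrite -{}cE.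
set c1 := last c0 p => ex; have c01 : connect exchange c0 c1 by apply/connectP; exists p.
apply: subv_trans (IH c1 c01 pp erefl).
have /exchangeP[e [j [f [ce fj vef ->]]]] := ex.
rewrite colour_swap //; case: eqP => [->|_]; last exact: subvv.
apply/vspan_subP => x /setIP[/setU1P[->|/setD1P[_ xc]] xR]; first exact: reach_span.
by apply: mem_vspan; apply/setIP.
Qed.

Lemma residue_span i : vspan (colour c0 i :&: residue) = vspan residue.
Proof.
apply/eqP; rewrite eqEsubv vspanS ?subsetIr //=; apply/vspan_subP => e.
rewrite inE => /existsP[c /andP[cc /eqP ce]].
exact: subvP (reach_subspan i cc) _ (reach_span i cc ce).
Qed.
End Reach.

Lemma optimal_exists : exists c, optimal c.
Proof.
have v0 : valid [ffun => None].
  apply/forallP => i; rewrite /indep; apply: leq_trans (leq0n _).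
  by rewrite leqn0 cards_eq0; apply/eqP/setP => e; rewrite !inE ffunE.
case: (@arg_maxnP _ [ffun => None] valid (fun c => #|coloured c|) v0) => c vc mc.
exists c; rewrite /optimal vc; apply/forallP => c'; apply/implyP; exact: mc.
Qed.

(** Edmonds' disjoint bases theorem for a family of vectors. In an optimal
    colouring the residue [R] is spanned by each class within [R], and
    everything outside [R] is coloured, so that the classes have together
    [m * \dim (vspan R) + #|~: R|] elements; by hypothesis this is at least
    [m] times the rank of the family. *)
Theorem disjoint_bases :
  (forall A, m * (\dim (vspan setT) - \dim (vspan A)) <= #|~: A|) ->
  exists c, forall i, indep (colour c i) /\ #|colour c i| = \dim (vspan setT).
Proof.
move=> hA; have [c0 oc] := optimal_exists; exists c0.
have /andP[/forallP vc _] := oc.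
set r := \dim (vspan setT); pose R := residue c0.
have le_r i : #|colour c0 i| <= r.
  by apply: leq_trans (vc i) _; apply: dimvS; apply/vspanS/subsetT.
have in_R i : #|colour c0 i :&: R| = \dim (vspan R).
  rewrite -(residue_span oc i); apply/eqP; rewrite eqn_leq dim_vspan andbT.
  by apply: (indepS (subsetIl _ _) (vc i)).
(* Each element outside the residue is counted by the class that it lies in. *)
have out_R : #|~: R| <= \sum_i #|colour c0 i :\: R|.
  under eq_bigr => i _ do rewrite -sum1_card.
  under eq_bigr => i _ do rewrite big_mkcond.
  rewrite exchange_big /= -sum1_card big_mkcond; apply: leq_sum => e _.
  case: ifP => // eR; case ce: (c0 e) => [i|].
    by rewrite (bigD1 i) //= in_setD -in_setC eR inE ce eqxx.
  by move: eR; rewrite inE (mem_residue (connect0 _ _) ce).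
have total : m * r <= \sum_i #|colour c0 i|.
  rewrite (eq_bigr (fun i => \dim (vspan R) + #|colour c0 i :\: R|)); last first.
    by move=> i _; rewrite -(cardsID R (colour c0 i)) in_R.
  rewrite big_split /= sum_nat_const card_ord.
  apply: leq_trans (leq_add (leqnn _) (leq_trans (hA R) out_R)).
  by rewrite -mulnDr leq_mul // -leq_subLR.
move=> i; split=> //; apply/eqP; rewrite eqn_leq le_r /=.
move: total; rewrite (bigD1 i) //= => total.
have sum_r : \sum_(j < m) r = m * r by rewrite sum_nat_const card_ord.
rewrite -(leq_add2r (\sum_(j < m | j != i) r)).
rewrite (bigD1 i) //= in sum_r; rewrite sum_r; apply: leq_trans total _.
by rewrite leq_add2l; apply: leq_sum.
Qed.
End VectorFamily.

(** * Packing spanning trees *)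

Section VertexSpace.
Variable T : finType.
Local Notation F2 := ('F_2)%type.
Local Notation vspaceT := {ffun T -> F2^o}.
Local Open Scope ring_scope.

Definition vertex_vec (x : T) : vspaceT := [ffun y => (y == x)%:R].

Definition sum_on (X : {set T}) (w : vspaceT) : F2^o := \sum_(x in X) w x.

Fact sum_on_linear X : linear (sum_on X).
Proof.
move=> t u w; rewrite /sum_on scaler_sumr -big_split /=.
by apply: eq_bigr => x _; rewrite !ffunE.
Qed.
HB.instance Definition _ X := GRing.isLinear.Build _ _ _ _ (sum_on X) (sum_on_linear X).

(** The kernel of a coordinate sum is the orthogonal of an indicator vector. For
    [X = setT] it has dimension one less than the number of vertices, and it
    contains every edge vector; for other [X] it contains the edge vectors of
    the edges that do not leave [X], so that it detects cuts. *)
Definition even_on (X : {set T}) : {vspace vspaceT} := lker (linfun (sum_on X)).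

Lemma mem_even_on X w : (w \in even_on X) = (sum_on X w == 0).
Proof. by rewrite memv_ker lfunE. Qed.

Lemma sum_on_vertex_vec X x : sum_on X (vertex_vec x) = (x \in X)%:R.
Proof.
rewrite /sum_on; case: (boolP (x \in X)) => xX.
  rewrite (bigD1 x) //= ffunE eqxx big1 ?addr0 // => y /andP[_ yx].
  by rewrite ffunE (negPf yx).
rewrite big1 // => y yX; rewrite ffunE; case: eqP => // yx.
by rewrite -yx yX in xX.
Qed.

Lemma F2_addrr (t : F2) : t + t = 0.
Proof. by apply: addrr_pchar2; apply: (@pchar_Fp 2). Qed.

Lemma mem_even_edge X x y :
  (vertex_vec x + vertex_vec y \in even_on X) = ((x \in X) == (y \in X)).
Proof.
rewrite mem_even_on linearD /= !sum_on_vertex_vec.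
by case: (x \in X); case: (y \in X); rewrite ?addr0 ?add0r ?F2_addrr ?eqxx.
Qed.

Lemma dim_space : \dim {: vspaceT} = #|T|.
Proof. by rewrite dimvf /= /dim /= muln1. Qed.

Lemma dim_even_on : (0 < #|T|)%N -> (\dim (even_on setT) < #|T|)%N.
Proof.
case/card_gt0P => x _; rewrite -dim_space ltnNge (geq_leqif (dimv_leqif_sup (subvf _))).
apply/negP => /subvP/(_ (vertex_vec x) (memvf _)); rewrite mem_even_on sum_on_vertex_vec inE.
by rewrite oner_eq0.
Qed.

Lemma vertex_space_addrr (w : vspaceT) : w + w = 0.
Proof. by apply/ffunP => x; rewrite !ffunE F2_addrr. Qed.
End VertexSpace.

Section GraphSpace.
Variable G : sgraph.

(** Edges as a type, so that the spans below are those of a family indexed by a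
    finite type. *)
Definition edge : finType := {f : {set G} | f \in edges G}.

(** The columns of the vertex-edge incidence matrix over the field with two
    elements: linear independence of edge vectors is acyclicity. *)
Definition edge_vec (e : edge) : {ffun G -> ('F_2)^o} := (\sum_(x in val e) vertex_vec x)%R.

Lemma edgesP (f : {set G}) :
  reflect (exists x y, [/\ adj x y, x != y & f = [set x; y]]) (f \in edges G).
Proof.
apply: (iffP imsetP) => [[[x y] /[!inE] /= xy ->]|[x [y [xy _ ->]]]]; last first.
  by exists (x, y); rewrite ?inE.
exists x, y; split=> //; apply: contraTneq xy => ->.
by rewrite adj_irrefl.
Qed.

Lemma edge_vecE (e : edge) x y : x != y -> val e = [set x; y] ->
  edge_vec e = (vertex_vec x + vertex_vec y)%R.
Proof. by move=> xy eE; rewrite /edge_vec eE big_setU1 ?inE //= big_set1. Qed.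

Lemma adj_inP (A : {set edge}) x y :
  reflect (x != y /\ exists2 e, e \in A & val e = [set x; y])
          (adj_in (val @: A) x y).
Proof.
apply: (iffP andP) => -[xy].
  by case/imsetP => e eA xyE; split=> //; exists e.
by case=> e eA eE; split=> //; rewrite -eE imset_f.
Qed.

(** The edge vectors along a path telescope: each inner vertex occurs twice, and
    [w + w = 0]. *)
Lemma path_vspan (A : {set edge}) x p : path (adj_in (val @: A)) x p ->
  (vertex_vec x + vertex_vec (last x p))%R \in vspan edge_vec A.
Proof.
elim: p x => [|y p IH] x /=; first by rewrite vertex_space_addrr mem0v.
case/andP=> /adj_inP[xy [e eA eE]] /IH yp.
have -> : (vertex_vec x + vertex_vec (last y p) =
    (vertex_vec x + vertex_vec y) + (vertex_vec y + vertex_vec (last y p)))%R.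
  by rewrite addrA -[(vertex_vec x + _ + _)%R]addrA vertex_space_addrr addr0.
by rewrite memvD // -(edge_vecE xy eE) mem_vspan.
Qed.

Lemma vspan_even (A : {set edge}) : (vspan edge_vec A <= even_on setT)%VS.
Proof.
apply/vspan_subP => e eA; have /edgesP[x [y [_ xy eE]]] := valP e.
by rewrite (edge_vecE xy eE) mem_even_edge !inE.
Qed.

(** The edges of a cycle other than its first edge [e] form a path between the
    ends of [e], so that the vector of [e] is in the span of the others. *)
Lemma indep_acyclic (A : {set edge}) : indep edge_vec A -> acyclic_by (val @: A).
Proof.
move=> iA [|x [|y [|z p]]] // _; set q := z :: p => /andP[].
rewrite [cycle _ _]/= [rcons _ _]/= => /andP[/adj_inP[xy [e eA eE]] yqx].
rewrite [uniq _]/= => /and3P[xq yq _].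
(* An edge other than [e] is recognised by one of its ends: the edges of the
   cycle within [y :: q] avoid [x], and the closing edge avoids [y]. *)
have keep u w : u != x -> adj_in (val @: A) u w -> (w != x) || (u != y) ->
    adj_in (val @: (A :\ e)) u w.
  move=> ux /adj_inP[uw [f fA fE]] wu; apply/adj_inP; split=> //; exists f => //.
  rewrite !inE fA andbT; apply: contraTneq wu => fe; rewrite negb_or !negbK.
  have : [set x; y] = [set u; w] by rewrite -eE -fE fe.
  move/setP => xyuw; have := xyuw x; have := xyuw u; rewrite !inE eqxx (negPf ux) /=.
  by rewrite (eq_sym x u) (negPf ux) (eq_sym x w) eqxx /= => -> <-.
case/negP: (indep_notin iA eA); rewrite (edge_vecE xy eE) addrC.
have -> : x = last y (rcons q x) by rewrite last_rcons.
have {}yqx : path (adj_in (val @: A)) y (rcons q x) by [].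
apply: path_vspan; move: yqx; rewrite !rcons_path => /andP[yqA lx].
have lq : last y q \in q by exact: (mem_last z p).
have lyq : last y q != y by apply: contraNneq yq => <-.
apply/andP; split; last first.
  apply: (keep _ _ _ lx); last by rewrite lyq orbT.
  by apply: contraNneq xq => <-; rewrite inE lq orbT.
have off_x : {in predC1 x &, subrel (adj_in (val @: A)) (adj_in (val @: (A :\ e)))}.
  by move=> u w ux wx uw; apply: keep => //; apply/orP; left.
apply: (sub_in_path off_x _ yqA); apply/allP => u uyq /=.
by apply: contraNneq xq => <-.
Qed.

(** By dimension the span is all of [even_on setT], so it contains the vector
    [vertex_vec x + vertex_vec y] even if [x] and [y] are not adjacent; but the
    span lies in [even_on X] for the component [X] of [x], whence [y] is in
    [X]. *)
Lemma base_connected (A : {set edge}) :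
  \dim (vspan edge_vec A) = #|G|.-1 -> connected_by (val @: A).
Proof.
move=> dA; apply/forallP => x; apply/forallP => y.
have spanA : vspan edge_vec A = even_on setT.
  have G0 : 0 < #|G| by apply/card_gt0P; exists x.
  by apply/eqP; rewrite eqEdim vspan_even dA -ltnS prednK // dim_even_on.
pose X := [set z | connect (adj_in (val @: A)) x z].
have spanX : (vspan edge_vec A <= even_on X)%VS.
  apply/vspan_subP => e eA; have /edgesP[u [w [_ uw eE]]] := valP e.
  rewrite (edge_vecE uw eE) mem_even_edge !inE.
  have uwA : adj_in (val @: A) u w by apply/adj_inP; split=> //; exists e.
  have wuA : adj_in (val @: A) w u.
    by apply/adj_inP; rewrite eq_sym; split=> //; exists e; rewrite // setUC.
  apply/eqP; apply/idP/idP => c.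
    exact: connect_trans c (connect1 uwA).
  exact: connect_trans c (connect1 wuA).
have xyA : (vertex_vec x + vertex_vec y)%R \in vspan edge_vec A.
  by rewrite spanA mem_even_edge !in_setT.
have := subvP spanX _ xyA; rewrite mem_even_edge /X !in_set connect0.
by move=> /eqP <-.
Qed.

Definition crossing (P : {set {set G}}) : {set {set G}} :=
  [set f in edges G | ~~ [exists X in P, f \subset X]].

(** One vertex vector per block, added to the edge vectors, generates the whole
    space, because any vertex is joined to the representative of its block. *)
Lemma dim_vspan_blocks (A : {set edge}) (P : {set {set G}}) :
  partition P [set: G] ->
  (forall x y, y \in pblock P x -> connect (adj_in (val @: A)) x y) ->
  #|G| <= \dim (vspan edge_vec A) + #|P|.
Proof.
move=> pP sameP; pose rep (X : {set G}) := oapp (@vertex_vec G) 0%R [pick y in X].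
pose U := (\sum_(X in P) <[rep X]>)%VS.
have dU : \dim U <= #|P|.
  apply: leq_trans (dimv_leq_sum _ _ _) _; rewrite -sum1_card.
  by apply: leq_sum => X _; rewrite dim_vline leq_b1.
apply: leq_trans (leq_add (leqnn _) dU).
apply: leq_trans (dimv_add_leqif _ _); rewrite -[X in X <= _]dim_space.
apply: dimvS; apply/subvP => w _.
have -> : w = (\sum_x w x *: vertex_vec x)%R.
  apply/ffunP => y; rewrite sum_ffunE (bigD1 y) // big1 => [|x xy].
    by rewrite Monoid.mulm1 !ffunE eqxx [RHS]mulr1.
  by rewrite !ffunE eq_sym (negPf xy) [LHS]mulr0.
apply: memv_suml => x _; apply: memvZ.
have xP : x \in cover P by rewrite (cover_partition pP) inE.
have : rep (pblock P x) \in U.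
  by rewrite memvE; apply: (sumv_sup (pblock P x)); rewrite ?pblock_mem.
rewrite /rep; case: pickP => [y yx|/(_ x)]; last by rewrite mem_pblock xP.
move=> yU; have /connectP[p pp yE] := sameP _ _ yx.
have := path_vspan pp; rewrite -yE => xy.
by rewrite -[vertex_vec x]addr0 -(vertex_space_addrr (vertex_vec y)) addrA memv_add.
Qed.

(** The packing theorem of Nash-Williams and Tutte. A set [A] of edges with
    components [P] has rank at least [#|G| - #|P|], and the edges crossing [P]
    are outside [A]; hence the condition on partitions gives the rank condition
    of [disjoint_bases]. The resulting bases have [#|G| - 1] elements, because
    the condition for the family of all edges forces that rank. *)
Theorem tree_packing (m : nat) :
  0 < #|G| ->
  (forall P, partition P [set: G] -> m * #|P|.-1 <= #|crossing P|) ->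
  exists T : 'I_m -> {set {set G}},
    [/\ forall i, is_spanning_tree (T i), forall i, #|T i| = #|G|.-1
      & forall i j, i != j -> [disjoint T i & T j]].
Proof.
move=> G0 hP; set n1 := #|G|.-1.
have hA (A : {set edge}) : m * (n1 - \dim (vspan edge_vec A)) <= #|~: A|.
  pose R := connect (adj_in (val @: A)).
  have symA : connect_sym (adj_in (val @: A)).
    by apply: sym_connect_sym => x y; rewrite /adj_in [LHS]/= [RHS]/= eq_sym setUC.
  have eqR : {in [set: G] & &, equivalence_rel R}.
    move=> x y z _ _ _; split; first exact: connect0.
    by move=> xy; apply/idP/idP; apply: connect_trans; rewrite // symA.
  pose P := equivalence_partition R setT.
  have pP : partition P setT := equivalence_partitionP eqR.
  apply: leq_trans (leq_trans (hP P pP) _); first rewrite leq_mul //.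
    suff le_G : #|G| <= \dim (vspan edge_vec A) + #|P|.
      by rewrite leq_subLR -ltnS prednK // (leq_trans le_G) // -addnS leq_add2l leqSpred.
    apply: dim_vspan_blocks pP _ => x y.
    by rewrite /P pblock_equivalence_partition ?inE.
  rewrite -(card_imset (mem (~: A)) val_inj); apply: subset_leq_card.
  apply/subsetP => f; rewrite inE => /andP[fE fP].
  apply/imsetP; exists (Sub f fE) => //; rewrite inE; apply: contra fP => fA.
  have /edgesP[x [y [_ xy fxy]]] := fE.
  apply/existsP; exists (pblock P x); rewrite pblock_mem ?(cover_partition pP) ?inE //=.
  rewrite fxy; apply/subsetP => z /set2P zxy.
  rewrite pblock_equivalence_partition ?inE //.
  case: zxy => ->; first exact: connect0.
  by apply: connect1; apply/adj_inP; split=> //; exists (Sub f fE).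
have rle A : \dim (vspan edge_vec A) <= n1.
  by rewrite -ltnS prednK //; apply: leq_ltn_trans (dimvS (vspan_even A)) (dim_even_on _).
have [c hc] : exists c : {ffun edge -> option 'I_m}, forall i,
   indep edge_vec (colour c i) /\ #|colour c i| = \dim (vspan edge_vec setT).
  apply: disjoint_bases => A; apply: leq_trans (hA A).
  by rewrite leq_mul // leq_sub2r.
exists (fun i => val @: colour c i).
have cn (i : 'I_m) : \dim (vspan edge_vec setT) = n1.
  have := hA setT; rewrite setCT cards0 leqn0 muln_eq0 subn_eq0.
  have m0 : m != 0 by rewrite -lt0n (leq_trans _ (ltn_ord i)).
  by rewrite (negPf m0) /= => n1le; apply/eqP; rewrite eqn_leq rle.
split=> [i|i|i j ij].
- have [ic dc] := hc i; split; last first.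
    by apply: base_connected; apply/eqP; rewrite eqn_leq rle -/n1 -(cn i) -dc.
  split; last exact: indep_acyclic.
  by apply/subsetP => _ /imsetP[e _ ->]; apply: valP.
- by rewrite card_imset; [rewrite (hc i).2 cn|apply: val_inj].
rewrite -setI_eq0; apply/eqP/setP => f; rewrite !inE; apply/negP => /andP[].
case/imsetP => e + -> /imsetP[e' + /val_inj ee']; rewrite -{}ee' !inE.
by move=> /eqP-> /eqP[] /eqP; rewrite (negPf ij).
Qed.
End GraphSpace.

(** * Boundaries of vertex sets *)

Lemma bigminn_le (I : finType) (Q : pred I) (F : I -> nat) d i :
  Q i -> \big[minn/d]_(j | Q j) F j <= F i.
Proof. by move=> Qi; have := bigmin_le_cond d F Qi; rewrite minEnat. Qed.

Section Cuts.
Variable G : sgraph.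
Implicit Types (X Y : {set G}) (P : {set {set G}}).

Definition boundary X : {set {set G}} :=
  [set f in edges G | [exists x in X, exists y in ~: X, f == [set x; y]]].

Definition cut X := #|boundary X|.

Lemma edges_between_cut X : edges_between X ([set: G] :\: X) = cut X.
Proof. by rewrite setTD. Qed.

Lemma mem_edges (x y : G) : ([set x; y] \in edges G) = adj x y.
Proof.
apply/edgesP/idP => [[u [w [uw uNw xyuw]]]|xy]; last first.
  by exists x, y; split=> //; apply: contraTneq xy => ->; rewrite adj_irrefl.
have /set2P xuw : x \in [set u; w] by rewrite -xyuw set21.
have /set2P yuw : y \in [set u; w] by rewrite -xyuw set22.
have /set2P wxy : w \in [set x; y] by rewrite xyuw set22.
have /set2P uxy : u \in [set x; y] by rewrite xyuw set21.
case: xuw yuw wxy uxy => -> [] -> wxy uxy //; last 2 first.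
- by rewrite adj_sym.
- by case: uxy => uw'; rewrite uw' eqxx in uNw.
by case: wxy => uw'; rewrite uw' eqxx in uNw.
Qed.

Lemma boundaryP X f :
  reflect (exists x y, [/\ adj x y, x \in X, y \notin X & f = [set x; y]])
          (f \in boundary X).
Proof.
rewrite inE; apply: (iffP andP) => [[fE]|[x [y [xy xX yX ->]]]]; last first.
  rewrite mem_edges xy; split=> //; apply/existsP; exists x; rewrite xX.
  by apply/existsP; exists y; rewrite inE yX /=.
case/existsP => x /andP[xX /existsP[y /andP[+ /eqP fxy]]]; rewrite inE => yX.
by exists x, y; split=> //; rewrite -mem_edges -fxy.
Qed.

(** A boundary edge has exactly one end in [X], so it comes from one ordered
    pair. *)
Lemma cut_sum X : cut X = \sum_(x in X) \sum_(y in ~: X) adj x y.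
Proof.
pose S := [set p : G * G | [&& p.1 \in X, p.2 \in ~: X & adj p.1 p.2]].
have -> : cut X = #|S|.
  rewrite -(@card_in_imset _ _ (fun p => [set p.1; p.2])); last first.
    move=> [x y] [u w] /=; rewrite !inE /= => /and3P[xX yX _] /and3P[uX wX _] xyuw.
    have : x \in [set u; w] by rewrite -xyuw set21.
    have : y \in [set u; w] by rewrite -xyuw set22.
    case/set2P => [yu|->]; first by rewrite yu uX in yX.
    by case/set2P => [->//|xw]; rewrite -xw xX in wX.
  apply: eq_card => f; apply/boundaryP/imsetP => [[x [y [xy xX yX ->]]]|].
    by exists (x, y); rewrite // !inE /= xX yX.
  case=> -[x y]; rewrite !inE /= => /and3P[xX yX xy] ->.
  by exists x, y.
rewrite pair_big_dep /= -sum1_card.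
under [LHS]eq_bigl => p do rewrite inE andbA.
by rewrite big_mkcondr; apply: eq_bigr => p _; case: (adj _ _).
Qed.

(** An edge belongs to the boundary of at most two blocks, those of its
    ends. *)
Lemma sum_cuts P : partition P [set: G] ->
  \sum_(X in P) cut X <= 2 * #|crossing P|.
Proof.
move=> pP; have tP : trivIset P by case/and3P: pP.
under eq_bigr => X _ do rewrite /cut -sum1_card big_mkcond.
rewrite exchange_big /= mulnC -sum_nat_const [leqRHS]big_mkcond /=.
apply: leq_sum => f _; case: (boolP (f \in crossing P)) => [|fP].
  rewrite /crossing inE => /andP[/edgesP[x [y [_ _ ->]]] _].
  rewrite -big_mkcondr sum1_card.
  apply: (@leq_trans #|[set pblock P x; pblock P y]|); last by rewrite cards2; case: (_ != _).
  apply: subset_leq_card; apply/subsetP => X /andP[XP /boundaryP[u [w [_ uX wX xyuw]]]].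
  have /set2P[xu|xu] : u \in [set x; y] by rewrite xyuw set21.
    by rewrite -xu (def_pblock tP XP uX) set21.
  by rewrite -xu (def_pblock tP XP uX) set22.
rewrite big1 // => X XP; case: ifP => // /boundaryP[x [y [xy xX yX fE]]].
case/negP: fP; rewrite /crossing inE fE mem_edges xy; apply/existsPn => Y; apply/negP => /andP[YP].
rewrite subUset !sub1set => /andP[xY yY].
by rewrite -(def_pblock tP XP xX) (def_pblock tP YP xY) yY in yX.
Qed.

Lemma degree_ge (x : G) : min_degree G <= degree x.
Proof. exact: bigminn_le. Qed.

(** Removing the boundary of [X] leaves no edge between [X] and the rest. *)
Lemma edge_connectivity_le X : X != set0 -> X != setT ->
  edge_connectivity G <= cut X.
Proof.
case/set0Pn => x xX; rewrite -subTset => /subsetPn[y _ yX].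
apply: bigminn_le; apply/andP; split; first by apply/subsetP => f; rewrite inE => /andP[].
apply/negP => /forallP/(_ x)/forallP/(_ y) xy; case/negP: yX.
rewrite -(closed_connect _ xy) // => u w /andP[_]; rewrite in_setD => /andP[uwX uwE].
have adj_uw : adj u w by rewrite -mem_edges.
apply/idP/idP; apply: contraTT => // wX; apply: contra uwX => uX; apply/boundaryP.
  by exists u, w.
by exists w, u; rewrite adj_sym setUC.
Qed.

(** In a set of [s] vertices each vertex sends at least [delta - (s - 1)] edges
    outside, and [s * (delta + 1 - s) >= delta] when [1 <= s <= delta]. *)
Lemma small_cut_card X : X != set0 -> cut X < min_degree G -> min_degree G < #|X|.
Proof.
rewrite -card_gt0 => X0; apply: contraTT; rewrite -!leqNgt => Xd.
have deg x : x \in X -> (min_degree G).+1 - #|X| <= \sum_(y in ~: X) adj x y.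
  move=> xX; rewrite leq_subLR; apply: leq_ltn_trans (degree_ge x) _.
  have -> : degree x = \sum_(y in X) adj x y + \sum_(y in ~: X) adj x y.
    rewrite /degree -sum1_card big_mkcond (bigID (mem X)) /=.
    by congr (_ + _); apply: eq_big => y; rewrite ?inE //; case: (adj _ _).
  rewrite -addSn leq_add2r (bigD1 x) //= adj_irrefl add0n -sum1_card (bigD1 x xX) /=.
  by rewrite add1n ltnS; apply: leq_sum => y _; case: (adj _ _).
rewrite cut_sum; apply: (@leq_trans (#|X| * ((min_degree G).+1 - #|X|))).
  by move: (#|X|) (min_degree G) X0 Xd => s d; nia.
by rewrite -sum_nat_const; apply: leq_sum.
Qed.

Lemma cut_setCU X Y : cut (~: (X :|: Y)) <= cut X + cut Y.
Proof.
apply: leq_trans (leq_card_setU _ _); apply: subset_leq_card; apply/subsetP => f.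
case/boundaryP => x [y [xy + + ->]].
rewrite !in_setC negbK !in_setU negb_or => /andP[xX xY] yXY; apply/orP.
by case/orP: yXY => [yX|yY]; [left|right]; apply/boundaryP; exists y, x; rewrite adj_sym setUC.
Qed.
End Cuts.

(** * Eigenvalues of real symmetric matrices *)

Local Open Scope ring_scope.

Section Eigen.
Variable R : realType.
Local Notation C := R[i].
Local Notation toC := (real_complex R).
Local Notation "A ^toC" := (map_mx toC A) (at level 8, format "A ^toC").
Local Notation "A ^*t" := (map_mx Num.conj A^T) (at level 8, format "A ^*t").

Lemma conj_real m n (A : 'M[R]_(m, n)) : map_mx Num.conj A^toC = A^toC.
Proof.
apply/matrixP => i j; rewrite !mxE; apply/CrealP/complex_realP.
by exists (A i j).
Qed.

(** The cross terms cancel because [A] is symmetric: this transfers a bound on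
    the quadratic form from real to complex vectors. *)
Lemma quad_complex n (A : 'M[R]_n) (a b : 'rV[R]_n) : A^T = A ->
  let v := a^toC + 'i *: b^toC in
  (v *m A^toC *m v^*t) 0 0 = toC ((a *m A *m a^T) 0 0 + (b *m A *m b^T) 0 0).
Proof.
move=> symA v.
have vt : v^*t = (a^T)^toC - 'i *: (b^T)^toC.
  rewrite /v linearD linearZ /= map_mxD map_mxZ !map_trmx !conj_real -scaleNr.
  by congr (_ + _ *: _); exact: conjCi.
have swap : (b *m A *m a^T) = (a *m A *m b^T).
  have -> : b *m A *m a^T = (b *m A *m a^T)^T by apply/matrixP => i j; rewrite [RHS]mxE !ord1.
  by rewrite !trmx_mul trmxK symA mulmxA.
rewrite vt /v !mulmxDl !mulmxDr !mulmxN -!scalemxAl -!scalemxAr -!map_mxM swap.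
rewrite scalerA mulCii scaleN1r opprK addrA.
rewrite !mxE rmorphD /=.
by rewrite subrK.
Qed.

(** The spectral theorem for a real symmetric matrix, with real eigenvalues but
    a complex unitary change of basis: this is why complex vectors enter the
    dimension count below. *)
Lemma sym_spectral n (A : 'M[R]_n) : A^T = A ->
  exists (P : 'M[C]_n) (d : 'I_n -> R),
    P \is unitarymx /\ A^toC = P^*t *m diag_mx (\row_j toC (d j)) *m P.
Proof.
move=> symA.
have hermA : A^toC \is hermsymmx.
  apply/is_hermitianmxP; rewrite expr0 scale1r.
  by rewrite map_trmx conj_real symA.
have /hermitian_spectral_diag_real /mxOverP realD := hermA.
have /hermitian_normalmx /orthomx_spectralP specA := hermA.
set P := spectralmx _ in specA; set D := spectral_diag _ in specA realD.
have uP : P \is unitarymx := spectral_unitarymx _.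
exists P, (fun j => complex.Re (D 0 j)); split=> //.
rewrite specA invmx_unitary //; congr (_ *m diag_mx _ *m _).
by apply/rowP => j; rewrite mxE RRe_real.
Qed.

Lemma char_poly_conj (F : fieldType) n (P A : 'M[F]_n) : P \in unitmx ->
  char_poly (invmx P *m A *m P) = char_poly A.
Proof.
move=> uP; rewrite /char_poly /char_poly_mx.
have uP' : map_mx polyC P \in unitmx.
  by rewrite unitmxE det_map_mx; apply: rmorph_unit; rewrite -unitmxE.
have -> : 'X%:M - map_mx polyC (invmx P *m A *m P) =
    map_mx polyC (invmx P) *m ('X%:M - map_mx polyC A) *m map_mx polyC P.
  rewrite mulmxBr mulmxBl !map_mxM; congr (_ - _).
  by rewrite scalar_mxC -mulmxA -map_mxM mulVmx // map_mx1 mulmx1.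
rewrite !det_mulmx mulrAC -det_mulmx -map_mxM mulVmx // map_mx1 det1 mul1r //.
Qed.

Lemma char_poly_sym n (A : 'M[R]_n) (P : 'M[C]_n) (d : 'I_n -> R) :
  P \is unitarymx -> A^toC = P^*t *m diag_mx (\row_j toC (d j)) *m P ->
  char_poly A = \prod_(x <- codom d) ('X - x%:P).
Proof.
move=> uP AE; apply: (map_poly_inj toC); rewrite map_char_poly AE.
rewrite -invmx_unitary // char_poly_conj ?unitarymx_unit //.
rewrite char_poly_trig ?diag_mx_is_trig // rmorph_prod big_image /=.
by apply: eq_bigr => j _; rewrite !mxE eqxx mulr1n map_polyXsubC.
Qed.

Lemma perm_eigenvalues n (A : 'M[R]_n) (s : seq R) :
  char_poly A = \prod_(x <- s) ('X - x%:P) -> perm_eq (eigenvalues A) s.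
Proof.
move=> chA; rewrite /eigenvalues perm_sort; set p := char_poly A.
have p0 : p != 0 by rewrite monic_neq0 ?char_poly_monic.
apply/allP => x _ /=; apply/eqP; rewrite count_flatten -map_comp.
rewrite -[in RHS]mu_prod_XsubC -chA -/p.
have uR : uniq (rootsR p) by apply: sorted_uniq (sorted_roots _ _ _); [exact: lt_trans|exact: ltxx].
rewrite (eq_map (g := fun y => (if y == x then mup x p else 0)%N)); last first.
  by move=> y /=; rewrite count_nseq /=; case: eqP => [->|_]; rewrite ?mul1n ?mul0n.
have [xR|xR] := boolP (x \in rootsR p).
  rewrite sumnE big_map (bigD1_seq x) //= eqxx big1 ?addn0 // => y yx.
  by rewrite (negPf yx).
rewrite mupNroot; last by move: xR; rewrite -roots_on_rootsR // in_itv.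
by rewrite sumnE big_map big1 // => y _; case: eqP.
Qed.

Lemma quad_spectral n (P : 'M[C]_n) (e : 'I_n -> R) (v : 'rV[C]_n) :
  let z := v *m P^*t in
  (v *m (P^*t *m diag_mx (\row_j toC (e j)) *m P) *m v^*t) 0 0 =
    \sum_j toC (e j) * `|z 0 j| ^+ 2.
Proof.
move=> z.
have zt : z^*t = P *m v^*t.
  rewrite /z trmx_mul map_mxM; congr (_ *m _).
  by apply/matrixP => i j; rewrite !mxE; exact: conjCK.
rewrite !mulmxA -(mulmxA _ P) -zt -/z mul_mx_diag mxE.
by apply: eq_bigr => j _; rewrite !mxE normCK mulrAC [toC _ * _]mulrC mulrAC.
Qed.

(** The dimension count of the Courant-Fischer theorem: if the row space of [W]
    had larger dimension than the number of nonnegative eigenvalues, it would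
    contain a nonzero complex vector without components on the corresponding
    eigenvectors, on which the form is negative. *)
Lemma card_nonneg_eigen n p (A : 'M[R]_n) (P : 'M[C]_n) (e : 'I_n -> R)
    (W : 'M[R]_(p, n)) :
  A^T = A -> P \is unitarymx -> A^toC = P^*t *m diag_mx (\row_j toC (e j)) *m P ->
  row_free W -> (forall y : 'rV[R]_p, 0 <= (y *m W *m A *m (y *m W)^T) 0 0) ->
  (p <= #|[set j | (0 <= e j)%R]|)%N.
Proof.
move=> symA uP AE freeW psd; set S := [set j | _]; rewrite leqNgt; apply/negP => ltS.
(* A row vector [y] with [y *m N = 0] gives a combination of the rows of [W]
   that is orthogonal to the eigenvectors indexed by [S]. *)
pose N : 'M[C]_(p, #|S|) := \matrix_(i, j) (W^toC *m P^*t) i (enum_val j).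
have /rowV0Pn[y yN y0] : kermx N != 0.
  rewrite -mxrank_eq0 mxrank_ker -lt0n subn_gt0.
  exact: leq_ltn_trans (rank_leq_col _) ltS.
have {}yN : y *m N = 0 by apply/eqP; rewrite -sub_kermx.
set v := y *m W^toC; set z := v *m P^*t.
have zS j : j \in S -> z 0 j = 0.
  move=> jS; have <- : (y *m N) 0 (enum_rank_in jS j) = 0 by rewrite yN mxE.
  rewrite /z /v -mulmxA !mxE.
  by apply: eq_bigr => i _; rewrite [in RHS]mxE enum_rankK_in.
have z0 : z != 0.
  apply: contraNneq y0 => z0; have v0 : v = 0.
    by rewrite -[v](mulmxKtV v uP erefl) -/z z0 mul0mx.
  have freeWC : row_free W^toC by rewrite row_free_map.
  by apply/eqP; apply: (row_free_inj freeWC); rewrite mul0mx.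
pose a := map_mx (@complex.Re R) y; pose b := map_mx (@complex.Im R) y.
have vE : v = (a *m W)^toC + 'i *: (b *m W)^toC.
  rewrite /v !map_mxM scalemxAl -mulmxDl; congr (_ *m _).
  by apply/rowP => j; rewrite !mxE [LHS]complexE.
have := quad_complex (a *m W) (b *m W) symA; rewrite /= -vE AE quad_spectral => qv.
have sum_ge0 : 0 <= \sum_j toC (e j) * `|z 0 j| ^+ 2.
  by rewrite qv ler0c addr_ge0.
have [j zj] : exists j, z 0 j != 0 by apply/rV0Pn.
have term_le0 i : toC (e i) * `|z 0 i| ^+ 2 <= 0.
  have [iS|] := boolP (i \in S); first by rewrite zS // normr0 expr0n mulr0.
  rewrite inE -ltNge => ei; apply: mulr_le0_ge0; last by rewrite exprn_ge0.
  by rewrite -(rmorph0 toC) lecR ltW.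
have : \sum_j toC (e j) * `|z 0 j| ^+ 2 < 0.
  rewrite (bigD1 j) //=; apply: (@le_lt_trans _ _ (toC (e j) * `|z 0 j| ^+ 2)).
    by rewrite gerDl sumr_le0.
  rewrite lt_neqAle term_le0 andbT mulf_neq0 ?expf_neq0 ?normr_eq0 //.
  have : j \notin S by apply: contra zj => /zS->.
  by rewrite inE -ltNge fmorph_eq0 => /lt_eqF->.
by rewrite (le_gtF sum_ge0).
Qed.

(** The order in which [eigenvalues] sorts the spectrum. *)
Let geR := fun x y : R => y <= x.
Let geR_trans : transitive geR.
Proof. by move=> y x z yx zy; apply: le_trans zy yx. Qed.

Lemma nth_sorted_ge (s : seq R) i mu : sorted (fun x y => y <= x) s ->
  (i < count (fun x => (mu <= x)%R) s)%N -> mu <= nth 0 s i.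
Proof.
move=> sorted_s; apply: contraTT; rewrite -ltNge -leqNgt => nth_lt.
rewrite -(cat_take_drop i s) count_cat.
rewrite [X in (_ + X)%N](_ : _ = 0)%N; last first.
  apply/eqP; rewrite -leqn0 leqNgt -has_count; apply/hasPn => _ /(nthP 0)[j jlt <-].
  rewrite nth_drop -ltNge; apply: le_lt_trans nth_lt; rewrite size_drop in jlt.
  apply: (sorted_leq_nth geR_trans (@lexx _ _) 0 sorted_s); rewrite ?inE ?leq_addr //.
  + by apply: leq_ltn_trans (leq_addr _ _) _; rewrite -ltn_subRL; apply: jlt.
  + by rewrite -ltn_subRL.
by rewrite addn0 (leq_trans (count_size _ _)) // size_take_min geq_minl.
Qed.

Lemma nth_sorted_le (s : seq R) i mu : sorted (fun x y => y <= x) s ->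
  (i < size s)%N -> (size s - i <= count (fun x => (x <= mu)%R) s)%N -> nth 0 s i <= mu.
Proof.
move=> sorted_s i_s; apply: contraTT; rewrite -ltNge -ltnNge => nth_gt.
rewrite -{1}(cat_take_drop i.+1 s) count_cat.
rewrite [X in (X + _)%N](_ : _ = 0)%N; last first.
  apply/eqP; rewrite -leqn0 leqNgt -has_count; apply/hasPn => _ /(nthP 0)[j jlt <-].
  rewrite size_takel // in jlt.
  rewrite nth_take // -ltNge; apply: lt_le_trans nth_gt _.
  by apply: (sorted_leq_nth geR_trans (@lexx _ _) 0 sorted_s); rewrite ?inE ?(leq_ltn_trans _ i_s).
rewrite add0n (leq_ltn_trans (count_size _ _)) // size_drop.
by rewrite ltn_sub2l.
Qed.

Lemma spectral_affine n (A : 'M[R]_n) (P : 'M[C]_n) (d : 'I_n -> R) s t :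
  P \is unitarymx -> A^toC = P^*t *m diag_mx (\row_j toC (d j)) *m P ->
  (s *: A + t%:M)^toC = P^*t *m diag_mx (\row_j toC (s * d j + t)) *m P.
Proof.
move=> uP AE; rewrite map_mxD map_mxZ map_scalar_mx AE.
have -> : \row_j toC (s * d j + t) = toC s *: (\row_j toC (d j)) + const_mx (toC t).
  by apply/rowP => j; rewrite !mxE rmorphD rmorphM.
rewrite linearD linearZ /= diag_const_mx mulmxDr mulmxDl -scalemxAr -scalemxAl.
by rewrite mul_mx_scalar -scalemxAl -invmx_unitary // mulVmx ?unitarymx_unit // scalemx1.
Qed.

Lemma sym_affine n (A : 'M[R]_n) (s t : R) : A^T = A ->
  (s *: A + t%:M)^T = s *: A + t%:M.
Proof. by move=> symA; rewrite linearD linearZ /= symA tr_scalar_mx. Qed.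

Lemma quad_affine n p (A : 'M[R]_n) (s t : R) (W : 'M[R]_(p, n)) (y : 'rV[R]_p) :
  (y *m W *m (s *: A + t%:M) *m (y *m W)^T) 0 0 =
  s * (y *m W *m A *m (y *m W)^T) 0 0 + t * ((y *m W) *m (y *m W)^T) 0 0.
Proof.
rewrite mulmxDr mulmxDl -scalemxAr -scalemxAl mul_mx_scalar -scalemxAl.
by rewrite mxE [X in X + _]mxE [X in _ + X]mxE.
Qed.

Lemma count_codom n (d : 'I_n -> R) (Q : pred R) :
  count Q (codom d) = #|[set j | Q (d j)]|.
Proof.
rewrite cardsE cardE /codom /image_mem count_map -size_filter /enum_mem -filter_predI.
by congr (size _); apply: eq_filter => j; rewrite /= !inE andbT.
Qed.

Lemma eigenvalues_sorted n (A : 'M[R]_n) : sorted geR (eigenvalues A).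
Proof. by apply: sort_sorted => x y; rewrite le_total. Qed.

(** The two halves of the Courant-Fischer theorem follow from
    [card_nonneg_eigen] applied to [A - mu] and to [mu - A], which have the same
    eigenvectors as [A]. *)
Lemma nth_eigenvalue_ge n p (A : 'M[R]_n) (W : 'M[R]_(p, n)) mu :
  A^T = A -> row_free W -> (0 < p)%N ->
  (forall y : 'rV[R]_p,
     mu * ((y *m W) *m (y *m W)^T) 0 0 <= (y *m W *m A *m (y *m W)^T) 0 0) ->
  mu <= nth_eigenvalue p A.
Proof.
move=> symA freeW p0 quad; have [P [d [uP AE]]] := sym_spectral symA.
apply: nth_sorted_ge (eigenvalues_sorted A) _; rewrite prednK //.
rewrite (permP (perm_eigenvalues (char_poly_sym uP AE))) count_codom.
have := card_nonneg_eigen (sym_affine 1 (- mu) symA) uP (spectral_affine 1 (- mu) uP AE) freeW.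
under eq_finset => j do rewrite mul1r subr_ge0.
by apply=> y; rewrite quad_affine mul1r mulNr subr_ge0.
Qed.

Lemma nth_eigenvalue_le n p (A : 'M[R]_n) (W : 'M[R]_(p, n)) mu :
  A^T = A -> row_free W -> (0 < p)%N ->
  (forall y : 'rV[R]_p,
     (y *m W *m A *m (y *m W)^T) 0 0 <= mu * ((y *m W) *m (y *m W)^T) 0 0) ->
  nth_eigenvalue (n - p).+1 A <= mu.
Proof.
move=> symA freeW p0 quad; have [P [d [uP AE]]] := sym_spectral symA.
have perm_d := perm_eigenvalues (char_poly_sym uP AE).
have size_n : size (eigenvalues A) = n.
  by rewrite (perm_size perm_d) size_codom card_ord.
have le_pn : (p <= n)%N by rewrite -(eqP freeW) rank_leq_col.
apply: nth_sorted_le (eigenvalues_sorted A) _ _; rewrite size_n.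
  by rewrite ltn_subrL p0 (leq_trans p0).
rewrite /= subKn // (permP perm_d) count_codom.
have := card_nonneg_eigen (sym_affine (-1) mu symA) uP (spectral_affine (-1) mu uP AE) freeW.
under eq_finset => j do rewrite mulN1r addrC subr_ge0.
by apply=> y; rewrite quad_affine mulN1r addrC subr_ge0.
Qed.
End Eigen.

(** * The quadratic form of a graph on step functions *)

Section QuadraticForm.
Variables (R : realType) (G : sgraph).
Implicit Types (f : G -> R) (a b : R).

Definition vertex_row f : 'rV[R]_#|G| := \row_j f (enum_val j).

(** Twice the quadratic form of the Laplacian, each edge being counted in both
    directions. *)
Definition energy f : R := \sum_u \sum_v (adj u v)%:R * (f u - f v) ^+ 2.

Lemma sum_enum_val (F : G -> R) : \sum_(j < #|G|) F (enum_val j) = \sum_u F u.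
Proof.
rewrite [RHS](reindex (fun j : 'I_#|G| => enum_val j)) //.
exact/onW_bij/enum_val_bij.
Qed.

Lemma degree_sum (u : G) : (degree u)%:R = \sum_v (adj u v)%:R :> R.
Proof.
rewrite /degree -sum1_card natr_sum big_mkcond; apply: eq_bigr => v _.
by rewrite inE; case: (adj u v).
Qed.

Lemma norm_vertex_row f : (vertex_row f *m (vertex_row f)^T) 0 0 = \sum_u f u ^+ 2.
Proof.
rewrite mxE -sum_enum_val; apply: eq_bigr => j _; by rewrite !mxE expr2.
Qed.

(** From [A = D - L] with [L] the Laplacian, [a D + b A = (a + b) D - b L]. *)
Lemma quad_vertex_row a b f :
  (vertex_row f *m (a *: degree_mx R G + b *: adjacency_mx R G) *m (vertex_row f)^T) 0 0 =
  (a + b) * (\sum_u (degree u)%:R * f u ^+ 2) - b / 2 * energy f.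
Proof.
have -> : energy f = 2 * (\sum_u (degree u)%:R * f u ^+ 2)
    - 2 * \sum_u \sum_v (adj u v)%:R * (f u * f v).
  have swap : \sum_u \sum_v (adj u v)%:R * f v ^+ 2 = \sum_u (degree u)%:R * f u ^+ 2.
    rewrite exchange_big; apply: eq_bigr => u _; rewrite degree_sum mulr_suml.
    by apply: eq_bigr => v _; rewrite adj_sym.
  have expand u v : (adj u v)%:R * (f u - f v) ^+ 2 =
     (adj u v)%:R * f u ^+ 2 + (adj u v)%:R * f v ^+ 2 - 2 * ((adj u v)%:R * (f u * f v)).
    by ring.
  rewrite /energy; under eq_bigr => u _ do under eq_bigr => v _ do rewrite expand.
  under eq_bigr => u _ do rewrite sumrB big_split /= -mulr_suml -degree_sum -mulr_sumr.
  by rewrite sumrB big_split /= swap -mulr_sumr; ring.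
rewrite mulmxDr mulmxDl -!scalemxAr -!scalemxAl mxE [X in X + _]mxE [X in _ + X]mxE.
have -> : (vertex_row f *m degree_mx R G *m (vertex_row f)^T) 0 0 = \sum_u (degree u)%:R * f u ^+ 2.
  rewrite mul_mx_diag mxE -sum_enum_val; apply: eq_bigr => j _.
  by rewrite !mxE mulrAC mulrC expr2.
have -> : (vertex_row f *m adjacency_mx R G *m (vertex_row f)^T) 0 0 =
    \sum_u \sum_v (adj u v)%:R * (f u * f v).
  rewrite mxE -sum_enum_val; apply: eq_bigr => j _.
  rewrite !mxE mulr_suml -sum_enum_val; apply: eq_bigr => i _.
  by rewrite !mxE adj_sym; ring.
by field.
Qed.

Lemma graph_mx_sym a b :
  (a *: degree_mx R G + b *: adjacency_mx R G)^T = a *: degree_mx R G + b *: adjacency_mx R G.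
Proof.
rewrite linearD !linearZ /= tr_diag_mx; congr (_ + _ *: _).
by apply/matrixP => i j; rewrite !mxE adj_sym.
Qed.
End QuadraticForm.

Section StepFunctions.
Variables (R : realType) (G : sgraph) (p : nat) (V : 'I_p -> {set G}).
Hypothesis disjV : forall i j, i != j -> [disjoint V i & V j].
Implicit Type y : 'rV[R]_p.

Definition step y (u : G) : R := \sum_i y 0 i * (u \in V i)%:R.

Definition indicators : 'M[R]_(p, #|G|) := \matrix_(i, j) (enum_val j \in V i)%:R.

Lemma mul_indicators y : y *m indicators = vertex_row (step y).
Proof. by apply/rowP => j; rewrite !mxE; apply: eq_bigr => i _; rewrite mxE. Qed.

Lemma in_disjoint i j u : u \in V i -> u \in V j -> j = i.
Proof.
move=> ui uj; apply: contraTeq uj => /disjV; rewrite disjoint_sym.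
by move/disjointFr ->.
Qed.

Lemma sum_in i u (F : 'I_p -> R) : u \in V i ->
  \sum_j F j * (u \in V j)%:R = F i.
Proof.
move=> ui; rewrite (bigD1 i) //= ui mulr1 big1 ?addr0 // => j ji.
by rewrite (_ : (u \in V j) = false) ?mulr0 //; apply: contraNF ji => /(in_disjoint ui)->.
Qed.

Lemma sum_out u (F : 'I_p -> R) : (forall i, u \notin V i) ->
  \sum_j F j * (u \in V j)%:R = 0.
Proof. by move=> out; rewrite big1 // => j _; rewrite (negPf (out j)) mulr0. Qed.

Lemma step_sqr y u : step y u ^+ 2 = \sum_i y 0 i ^+ 2 * (u \in V i)%:R.
Proof.
rewrite /step; case: (pickP (fun i => u \in V i)) => [i ui|out].
  by rewrite !(sum_in _ ui).
have {}out i : u \notin V i by rewrite out.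
by rewrite !sum_out // expr0n.
Qed.

Lemma norm_step y : \sum_u step y u ^+ 2 = \sum_i y 0 i ^+ 2 * #|V i|%:R.
Proof.
under eq_bigr => u _ do rewrite step_sqr.
rewrite exchange_big; apply: eq_bigr => i _; rewrite -mulr_sumr; congr (_ * _).
by rewrite -sum1_card natr_sum [RHS]big_mkcond; apply: eq_bigr => u _; case: (u \in _).
Qed.

Lemma indicators_free : (forall i, V i != set0) -> row_free indicators.
Proof.
move=> V0; apply/inj_row_free => y; rewrite mul_indicators => y0.
apply/rowP => i; rewrite mxE; have /set0Pn[u ui] := V0 i.
have := congr1 (fun x : 'rV_ _ => x 0 (enum_rank u)) y0.
by rewrite !mxE enum_rankK /step (sum_in _ ui).
Qed.

(** The share of the pair [u, v] in the energy of [step y]: summed over the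
    adjacent pairs it gives each [y 0 i ^+ 2] the factor [cut (V i)]. *)
Definition leaving y (u v : G) : R := \sum_i y 0 i ^+ 2 * ((u \in V i) && (v \notin V i))%:R.

Lemma leaving_ge0 y u v : 0 <= leaving y u v.
Proof. by apply: sumr_ge0 => i _; rewrite mulr_ge0 ?sqr_ge0. Qed.

Lemma sqr_le_leaving y u v : (forall i, u \in V i -> v \notin V i) ->
  step y u ^+ 2 <= leaving y u v.
Proof.
move=> sep; rewrite step_sqr; apply: ler_sum => i _; rewrite ler_wpM2l ?sqr_ge0 //.
by case: (boolP (u \in V i)) => // /sep->.
Qed.

(** The difference vanishes if [u] and [v] lie in a common set of [V];
    otherwise this is [(s - t) ^+ 2 <= 2 * (s ^+ 2 + t ^+ 2)]. *)
Lemma step_diff y u v : (step y u - step y v) ^+ 2 <= 2 * (leaving y u v + leaving y v u).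
Proof.
have l0 := leaving_ge0 y u v; have l1 := leaving_ge0 y v u.
case: (pickP (fun i => (u \in V i) && (v \in V i))) => [i /andP[ui vi]|sep].
  rewrite /step !(sum_in _ ui) !(sum_in _ vi) subrr expr0n /=; lra.
have := @sqr_le_leaving y u v; have := @sqr_le_leaving y v u.
have h i : u \in V i -> v \notin V i by move=> ui; have := sep i; rewrite ui /= => ->.
have h' i : v \in V i -> u \notin V i by move=> vi; have := sep i; rewrite vi andbT /= => ->.
move=> /(_ h') le_v /(_ h) le_u.
by have := sqr_ge0 (step y u + step y v); rewrite sqrrD sqrrB; lra.
Qed.

Lemma energy_step y : energy (step y) <= 4 * \sum_i y 0 i ^+ 2 * (cut (V i))%:R.
Proof.
have sum_leaving : \sum_u \sum_v (adj u v)%:R * leaving y u v = \sum_i y 0 i ^+ 2 * (cut (V i))%:R.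
  rewrite /leaving.
  under eq_bigr => u _ do under eq_bigr => v _ do rewrite mulr_sumr.
  under eq_bigr => u _ do rewrite exchange_big.
  rewrite exchange_big; apply: eq_bigr => i _; rewrite cut_sum natr_sum mulr_sumr.
  rewrite [RHS]big_mkcond; apply: eq_bigr => u _.
  case: (boolP (u \in V i)) => ui; last by rewrite big1 // => v _; rewrite !mulr0.
  rewrite natr_sum mulr_sumr [RHS]big_mkcond; apply: eq_bigr => v _.
  rewrite in_setC; case: (v \in V i); rewrite /= ?mulr0 //; ring.
have sum_leaving' : \sum_u \sum_v (adj u v)%:R * leaving y v u = \sum_i y 0 i ^+ 2 * (cut (V i))%:R.
  rewrite -sum_leaving exchange_big; apply: eq_bigr => u _; apply: eq_bigr => v _.
  by rewrite adj_sym.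
have <- : \sum_u \sum_v (adj u v)%:R * (2 * (leaving y u v + leaving y v u)) =
    4 * \sum_i y 0 i ^+ 2 * (cut (V i))%:R.
  under eq_bigr => u _ do under eq_bigr => v _ do rewrite mulrCA mulrDr.
  under eq_bigr => u _ do rewrite -mulr_sumr big_split.
  rewrite -mulr_sumr big_split /= sum_leaving sum_leaving'; ring.
by apply: ler_sum => u _; apply: ler_sum => v _; rewrite ler_wpM2l ?step_diff.
Qed.

End StepFunctions.

Section SmallCuts.
Variables (R : realType) (G : sgraph) (p c : nat) (V : 'I_p -> {set G}).
Hypotheses (disjV : forall i j, i != j -> [disjoint V i & V j])
  (V_neq0 : forall i, V i != set0) (cutV : forall i, (cut (V i) <= c)%N)
  (small_c : (c < min_degree G)%N) (p_gt0 : (0 < p)%N).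
Variables (a b : R).
Local Notation delta := ((min_degree G)%:R : R).
Local Notation M := (a *: degree_mx R G + b *: adjacency_mx R G).
Local Notation theta := (2 * c%:R / (delta + 1) : R).

(** Passing from the sum of the [y 0 i ^+ 2] to the norm of the step function
    gains the factor [delta + 1], because a set with so small a boundary has
    more than [delta] vertices. *)
Lemma energy_small_cuts y : energy (step V y) / 2 <= theta * \sum_u step V y u ^+ 2.
Proof.
have d1 : 0 < delta + 1 by rewrite ltr_wpDl.
apply: (@le_trans _ _ (2 * c%:R * \sum_i y 0 i ^+ 2)).
  have := energy_step disjV y.
  suff : \sum_i y 0 i ^+ 2 * (cut (V i))%:R <= c%:R * \sum_i y 0 i ^+ 2 by lra.
  rewrite mulr_sumr; apply: ler_sum => i _; rewrite mulrC ler_wpM2r ?sqr_ge0 //.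
  by rewrite ler_nat.
rewrite norm_step // [leRHS]mulrAC ler_pdivlMr // -[leLHS]mulrA ler_wpM2l ?mulr_ge0 //.
rewrite mulr_suml; apply: ler_sum => i _; rewrite ler_wpM2l ?sqr_ge0 //.
by rewrite natr1 ler_nat small_cut_card // (leq_ltn_trans (cutV i)).
Qed.

Lemma degree_energy y :
  delta * \sum_u step V y u ^+ 2 <= \sum_u (degree u)%:R * step V y u ^+ 2.
Proof.
rewrite mulr_sumr; apply: ler_sum => u _; rewrite ler_wpM2r ?sqr_ge0 //.
by rewrite ler_nat degree_ge.
Qed.

(** The signs of [b] and [a + b] decide in which direction the bounds on the
    energy and on the degrees act, and hence whether the step functions bound
    the [p]-th eigenvalue from below or the [p]-th one from the bottom from
    above. *)
Lemma eigenvalue_ge_small_cuts : 0 <= b -> 0 <= a + b ->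
  (a + b) * delta - b * theta <= nth_eigenvalue p M.
Proof.
move=> b0 ab0.
apply: nth_eigenvalue_ge (graph_mx_sym _ _ _) (indicators_free R disjV V_neq0)
  p_gt0 _ => y.
rewrite mul_indicators quad_vertex_row norm_vertex_row.
have := ler_wpM2l ab0 (degree_energy y); have := ler_wpM2l b0 (energy_small_cuts y).
move: (energy _) (\sum_u step V y u ^+ 2) (\sum_u _ * _) theta => e s t h; lra.
Qed.

Lemma eigenvalue_le_small_cuts : b <= 0 -> a + b <= 0 ->
  nth_eigenvalue (#|G| - p).+1 M <= (a + b) * delta - b * theta.
Proof.
move=> b0 ab0.
apply: nth_eigenvalue_le (graph_mx_sym _ _ _) (indicators_free R disjV V_neq0)
  p_gt0 _ => y.
rewrite mul_indicators quad_vertex_row norm_vertex_row.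
have := ler_wnM2l ab0 (degree_energy y); have := ler_wnM2l b0 (energy_small_cuts y).
move: (energy _) (\sum_u step V y u ^+ 2) (\sum_u _ * _) theta => e s t h; lra.
Qed.
End SmallCuts.

(** * Small cuts and the spectral condition *)

(** With [c = 2 k + 1], the [theta] of the preceding bounds stays below the
    threshold of the theorem: since [1 / d <= 1 / 2], the claim reduces to
    [3 * (4 k + 2) <= 16 k + 8]. *)
Lemma threshold_bound (R : realType) (k d : nat) : (2 <= d)%N ->
  2 * (2 * k + 1)%N%:R / (d%:R + 1) <=
  16 * (k%:R + (d%:R - 1) / d%:R) / (3 * (d%:R + 1)) :> R.
Proof.
move=> d2; have d2R : 2 <= d%:R :> R by rewrite (ler_nat _ 2).
have dV : d%:R^-1 <= 2^-1 :> R by rewrite lef_pV2 ?posrE //; lra.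
have d1 : 0 < d%:R + 1 :> R by lra.
have -> : (d%:R - 1) / d%:R = 1 - d%:R^-1 :> R.
  by rewrite mulrBl divff ?mul1r //; apply: lt0r_neq0; lra.
have k0 : 0 <= k%:R :> R by [].
rewrite invfM mulrA ler_wpM2r ?invr_ge0 ?(ltW d1) //.
rewrite natrD natrM; lra.
Qed.

Section SpectralCondition.
Variables (R : realType) (a b : R) (k : nat) (G : sgraph).
Hypotheses (ha : -1 <= a) (hb : b != 0) (hab : -1 <= a / b)
  (hdelta : (2 * k + 2 <= min_degree G)%N) (k_gt0 : (0 < k)%N).
Local Notation d := ((min_degree G)%:R : R).
Local Notation gap := (16 * (k%:R + (d - 1) / d) / (3 * (d + 1))).

Definition spectral_condition : Prop :=
  [\/ lambda1 3 G a < (a + 1) * d - 16 * (k%:R + (d - 1) / d) / (3 * (d + 1)),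
      0 < b /\ lambda2 3 G a b < (a + b) * d - 16 * b * (k%:R + (d - 1) / d) / (3 * (d + 1))
    | b < 0 /\ (a + b) * d - 16 * b * (k%:R + (d - 1) / d) / (3 * (d + 1))
        < lambda2 (#|G| - 2) G a b].

(** By [threshold_bound] the Courant-Fischer bounds contradict each of the three
    conditions; the first one is the case [b = 1] of the second. *)
Lemma three_small_cuts (X Y Z : {set G}) :
  [/\ X != set0, Y != set0 & Z != set0] ->
  [/\ [disjoint X & Y], [disjoint Y & Z] & [disjoint Z & X]] ->
  [/\ cut X <= 2 * k + 1, cut Y <= 2 * k + 1 & cut Z <= 2 * k + 1]%N ->
  ~ spectral_condition.
Proof.
move=> [X0 Y0 Z0] [XY YZ ZX] [cX cY cZ].
pose V (i : 'I_3) : {set G} := tnth [tuple X; Y; Z] i.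
have disjV i j : i != j -> [disjoint V i & V j].
  by case: i j => [[|[|[|i]]] // ?] [[|[|[|j]]] // ?]; rewrite /V !(tnth_nth set0) //= disjoint_sym.
have V_neq0 i : V i != set0.
  by case: i => [[|[|[|i]]] // ?]; rewrite /V (tnth_nth set0).
have cutV i : (cut (V i) <= 2 * k + 1)%N.
  by case: i => [[|[|[|i]]] // ?]; rewrite /V (tnth_nth set0).
have small : (2 * k + 1 < min_degree G)%N by lia.
have G3 : (2 < #|G|)%N.
  have [x _] := set0Pn _ X0.
  apply: (@leq_trans (degree x)); first by apply: leq_trans (degree_ge x); lia.
  exact: max_card.
have gapE : 2 * (2 * k + 1)%N%:R / (d + 1) <= gap by apply: threshold_bound; lia.
have gap_b : 16 * b * (k%:R + (d - 1) / d) / (3 * (d + 1)) = b * gap by ring.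
rewrite /spectral_condition gap_b; move: gapE; set g := gap => gapE.
have ab : a + b = b * (a / b + 1) by field.
case=> [|[b0]|[b0]].
- have := @eigenvalue_ge_small_cuts R G 3 _ V disjV V_neq0 cutV small isT a 1 ler01.
  rewrite /lambda1 scale1r mul1r => ge_l lt_l.
  have /ge_l : 0 <= a + 1 by rewrite -lerBlDr sub0r.
  by rewrite leNgt => /negP; apply; apply: lt_le_trans lt_l _; rewrite lerD2l lerN2.
- have := @eigenvalue_ge_small_cuts R G 3 _ V disjV V_neq0 cutV small isT a b (ltW b0).
  rewrite /lambda2 => ge_l lt_l.
  have /ge_l : 0 <= a + b by rewrite ab mulr_ge0 ?(ltW b0) // -lerBlDr sub0r.
  rewrite leNgt => /negP; apply; apply: lt_le_trans lt_l _.
  by rewrite lerD2l lerN2 ler_wpM2l // ltW.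
have := @eigenvalue_le_small_cuts R G 3 _ V disjV V_neq0 cutV small isT a b (ltW b0).
rewrite -subSn // subSS /lambda2 => le_l lt_l.
have /le_l : a + b <= 0 by rewrite ab mulr_le0_ge0 ?(ltW b0) // -lerBlDr sub0r.
rewrite leNgt => /negP; apply; apply: le_lt_trans lt_l.
by rewrite lerD2l lerN2 ler_wnM2l // ltW.
Qed.

(** If the edge connectivity were at most [k], the two minimum cuts given by the
    class would have boundaries of at most [k] edges, and the set of the
    remaining vertices one of at most [2 k] edges. *)
Lemma edge_connectivity_gt : in_class 1 G -> spectral_condition ->
  (k < edge_connectivity G)%N.
Proof.
move=> [V [V0 disjV outV cutV]] cond; rewrite ltnNge; apply/negP => small.
pose X := V ord0; pose Y := V (lift ord0 ord0).
have cX : cut X = edge_connectivity G by rewrite (cutV ord0) edges_between_cut.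
have cY : cut Y = edge_connectivity G by rewrite (cutV (lift ord0 ord0)) edges_between_cut.
apply: (@three_small_cuts X Y (~: (X :|: Y))) cond.
- split; [by case: (V0 ord0) | by case: (V0 (lift ord0 ord0)) |].
  by move: outV; rewrite setTD big_ord_recl big_ord1.
- split; first exact: disjV.
    by rewrite disjoints_subset setCK subsetUr.
  by rewrite disjoint_sym disjoints_subset setCK subsetUl.
by have := cut_setCU X Y; rewrite cX cY; split; lia.
Qed.

(** At most two blocks have fewer than [2 k + 2] boundary edges, and these still
    have [k + 1]; the boundary edges of all blocks are then at least
    [2 (k + 1) + (#|P| - 2) (2 k + 2)], and each edge is counted at most twice. *)
Lemma crossing_bound (P : {set {set G}}) : in_class 1 G -> spectral_condition ->
  partition P [set: G] -> (k.+1 * #|P|.-1 <= #|crossing P|)%N.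
Proof.
move=> hG cond pP; have [P1|P2] := leqP #|P| 1.
  by rewrite (_ : #|P|.-1 = 0%N) ?muln0 //; lia.
have P0 : set0 \notin P by case/and3P: pP.
have tP : trivIset P by case/and3P: pP.
have neq0 X : X \in P -> X != set0 by move=> XP; apply: contraNneq P0 => <-.
have kcut X : X \in P -> (k < cut X)%N.
  move=> XP; apply: leq_trans (edge_connectivity_gt hG cond) _.
  apply: edge_connectivity_le (neq0 X XP) _.
  apply: contraTneq P2 => XT; rewrite -leqNgt -(cards1 X); apply: subset_leq_card.
  apply/subsetP => Y YP; rewrite inE; apply: contraT => YX.
  have := trivIsetP tP Y X YP XP YX; rewrite XT disjoints_subset setCT subset0.
  by rewrite (negPf (neq0 Y YP)).
pose Q := [set X in P | (cut X <= 2 * k + 1)%N].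
have Q2 : (#|Q| <= 2)%N.
  rewrite leqNgt; apply/negP => /card_gt2P[X [Y [Z [[XQ YQ ZQ] [XY YZ ZX]]]]].
  move: XQ YQ ZQ; rewrite !inE => /andP[XP cX] /andP[YP cY] /andP[ZP cZ].
  apply: (@three_small_cuts X Y Z) cond => //; split; rewrite ?neq0 //.
  - exact: trivIsetP tP _ _ XP YP XY.
  - exact: trivIsetP tP _ _ YP ZP YZ.
  exact: trivIsetP tP _ _ ZP XP ZX.
have PQ : (#|P| <= #|Q| + #|P :\: Q|)%N.
  have := cardsID Q P. have := subset_leq_card (subsetIr P Q). lia.
have := sum_cuts pP.
rewrite (big_setID Q) /= (setIidPr _); last by apply/subsetP => X; rewrite inE => /andP[].
have : (\sum_(X in Q) (k.+1) <= \sum_(X in Q) cut X)%N.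
  by apply: leq_sum => X; rewrite inE => /andP[/kcut].
have : (\sum_(X in P :\: Q) (2 * k.+1) <= \sum_(X in P :\: Q) cut X)%N.
  apply: leq_sum => X; rewrite !inE => /andP[+ XP]; rewrite XP /= -ltnNge; lia.
rewrite !sum_nat_const; move: P2 Q2 PQ.
move: (#|P|) (#|Q|) (#|P :\: Q|) (\sum_(X in _) _)%N (\sum_(X in _) _)%N (#|crossing P|).
move=> p q r s t c; nia.
Qed.
End SpectralCondition.

Theorem corollary3p1 (R : realType) (a b : R)
    (ha : -1 <= a) (hb : b != 0) (hab : -1 <= a / b)
    (k : nat) (hk : (2 <= k)%N)
    (G : sgraph) (hG : in_class 1 G)
    (n : nat) (hn : #|G| = n)
    (delta : nat) (hdelta : min_degree G = delta)
    (hdeltak : (2 * k + 2 <= delta)%N)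
    (hcond :
      [\/ lambda1 3 G a <
            (a + 1) * delta%:R
              - 16 * (k%:R + (delta%:R - 1) / delta%:R) / (3 * (delta%:R + 1)),
          0 < b /\
          lambda2 3 G a b <
            (a + b) * delta%:R
              - 16 * b * (k%:R + (delta%:R - 1) / delta%:R)
                  / (3 * (delta%:R + 1))
        | b < 0 /\
          (a + b) * delta%:R
              - 16 * b * (k%:R + (delta%:R - 1) / delta%:R)
                  / (3 * (delta%:R + 1))
            < lambda2 (n - 2) G a b]) :
  propertyP k delta G.
Proof.
subst n delta.
have [x _] : exists x, x \in [set: G].
  by case: hG => V [V0 _ _ _]; have [/set0Pn[x _] _] := V0 ord0; exists x; rewrite inE.
have G2 : (2 <= #|G|)%N.
  apply: (@leq_trans (degree x)); last exact: max_card.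
  by apply: leq_trans (degree_ge x); lia.
have [|T [treeT sizeT disjT]] := @tree_packing G k.+1 (ltnW G2).
  by move=> P pP; apply: (@crossing_bound R a b) pP => //; lia.
exists (fun i => T (widen_ord (leqnSn k) i)); split => [i|i j ij|]; first exact: treeT.
  by apply: disjT; apply: contra ij => /eqP[ij]; apply/eqP/val_inj.
exists (T ord_max); split.
- by case: (treeT ord_max).
- by move=> i; apply: disjT; rewrite neq_ltn /= ltn_ord orbT.
- rewrite sizeT -subn1 natrB 1?ltnW //.
  have d2 : 2 <= (min_degree G)%:R :> rat by rewrite (ler_nat _ 2); lia.
  have n2 : 2 <= #|G|%:R :> rat by rewrite (ler_nat _ 2).
  rewrite mulrAC ltr_pdivrMr; last lra.
  nra.
by case: (treeT ord_max) => [forestT connT] notT; case: notT.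
Qed.
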